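(* Let $a<b$ and $c<d$ be real numbers, let $\Delta=[a,b]\times[c,d]\subset\mathbb{R}^2$, and let $f:\Delta\to\mathbb{R}$ be a coordinated Godunova-Levin function on $\Delta$ (that is, $f$ belongs to the class $QX(f,\Delta)$). Suppose that $f_x\in L_1[c,d]$ for all $x\in[a,b]$ and $f_y\in L_1[a,b]$ for all $y\in[c,d]$. Then $$\frac{1}{16}\, f\left(\frac{a+b}{2},\frac{c+d}{2}\right)\le \frac18\left[\frac{1}{b-a}\int_a^b f\left(x,\frac{c+d}{2}\right)dx+\frac{1}{d-c}\int_c^d f\left(\frac{a+b}{2},y\right)dy\right]\le \frac{1}{(b-a)(d-c)}\int_a^b\int_c^d f(x,y)\,dy\,dx .$$
   Context: A function $h:I\subseteq\mathbb{R}\to\mathbb{R}$ on an interval $I$ belongs to the class $Q(I)$ (Godunova-Levin functions) if it is nonnegative and for all $u,v\in I$ and $\lambda\in(0,1)$, $h(\lambda u+(1-\lambda)v)\le \frac{h(u)}{\lambda}+\frac{h(v)}{1-\lambda}$. For $f:\Delta=[a,b]\times[c,d]\to\mathbb{R}$, the partial mappings are $f_y:[a,b]\to\mathbb{R}$, $f_y(u)=f(u,y)$ (for $y\in[c,d]$) and $f_x:[c,d]\to\mathbb{R}$, $f_x(v)=f(x,v)$ (for $x\in[a,b]$). The function $f$ is called a coordinated Godunova-Levin function on $\Delta$ if $f_y\in Q([a,b])$ for all $y\in[c,d]$ and $f_x\in Q([c,d])$ for all $x\in[a,b]$; this class is denoted $QX(f,\Delta)$. *)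

(* Defs.v *)
From HB Require Import structures.
From mathcomp Require Import all_boot all_order all_algebra.
From mathcomp Require Import all_classical all_reals all_analysis.
From mathcomp Require Import measurable_realfun.

Set Implicit Arguments.
Unset Strict Implicit.
Unset Printing Implicit Defensive.

Import Order.TTheory GRing.Theory Num.Theory.
Import numFieldNormedType.Exports.

Local Open Scope classical_set_scope.
Local Open Scope ring_scope.

(* The class Q(I); [h] is total, but only its values on [I] matter. *)
Definition godunova_levin (R : realType) (I : interval R) (h : R -> R) : Prop :=
  (forall u, u \in I -> 0 <= h u) /\
  (forall u v l, u \in I -> v \in I -> 0 < l < 1 ->
    h (l * u + (1 - l) * v) <= h u / l + h v / (1 - l)).

(* The class QX(f, [a, b] x [c, d]); again [f] is total, but only its values on
   the rectangle matter. *)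
Definition coord_godunova_levin (R : realType) (a b c d : R)
    (f : R -> R -> R) : Prop :=
  (forall y, y \in `[c, d] -> godunova_levin `[a, b] (f ^~ y)) /\
  (forall x, x \in `[a, b] -> godunova_levin `[c, d] (f x)).

(* [lebesgue_measure] is the restriction of the Lebesgue measure to the Borel
   sets; its completion is used so that all the Lebesgue measurable functions
   are covered. *)
Definition L1_itv (R : realType) (a b : R) (h : R -> R) : Prop :=
  (@completed_lebesgue_measure R).-integrable `[a, b] (EFin \o h).

(* Extended-real valued: integrable sections of a coordinated Godunova-Levin
   function may have an infinite iterated integral, and a real-valued integral
   would then be 0.  When the inner integral, a nonnegative function, is not
   measurable, the outer integral is the supremum of the integrals of its
   simple minorants. *)
Definition integral_itv (R : realType) (a b : R) (h : R -> \bar R) : \bar R :=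
  (\int[@completed_lebesgue_measure R]_(x in `[a, b]) h x)%E.

(* Main.v *)
Require Import Defs.
From HB Require Import structures.
From mathcomp Require Import all_boot all_order all_algebra.
From mathcomp Require Import all_classical all_reals all_analysis.
From mathcomp Require Import measurable_realfun.
From mathcomp Require Import ring lra.

Set Implicit Arguments.
Unset Strict Implicit.
Unset Printing Implicit Defensive.

Import Order.TTheory GRing.Theory Num.Theory.
Import numFieldNormedType.Exports.

Local Open Scope classical_set_scope.
Local Open Scope ring_scope.

(** Write m and m' for the midpoints of [a, b] and [c, d].  Everything follows
    from the one-dimensional midpoint inequality (b - a) / 4 * h(m) <=
    \int_a^b h (lemma [godunova_levin_midpoint]).  Applied to the
    midline sections f(., m') and f(m, .), it gives the first inequality.  For
    the second one, g(x) = \int_c^d f(x, y) dy is again a Godunova-Levin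
    function (lemma [godunova_levin_integral]).  The inequality for f(x, .)
    bounds f(x, m') by a multiple of g(x), which bounds the first middle term
    by half of the right-hand side, and the inequality for g bounds the second
    one, since g(m) = \int_c^d f(m, y) dy.

    The difficulty is that g need not be measurable: separate measurability
    of f says nothing about x |-> \int f(x, y) dy.  Its integral is then a
    lower integral, which is superadditive but not additive, so that the usual
    argument, integrating h(m) <= 2 (h(x) + h(a + b - x)), fails: the lower
    integral of h(x) + h(a + b - x) can exceed twice the lower integral of h.
    The cure uses points that are not symmetric.  With p(s) = s h(m - s) and
    q(t) = t h(m + t), the Godunova-Levin inequality at m, between m - s and
    m + t, reads
      p(s) + q(t) >= h(m) s t / (s + t) >= (h(m) / 2) min(s, t).
    Hence the greatest nondecreasing minorant N of p, with a suitable cap,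
    still satisfies (h(m) / 2) s - N(s) <= q(s): lemma
    [nondecreasing_separation].  Being monotone, N is Borel, and it yields a
    Borel function psi <= h such that psi(x) + psi(a + b - x) >= h(m) / 2
    (lemma [godunova_levin_minorant]).  The symmetrization argument applies to
    psi, and the integral of psi is at most the lower integral of h. *)

(** The domain of the completed Lebesgue measure: the real line with the
    Caratheodory-measurable sets. *)
Local Notation completedR R :=
  (caratheodory_type (wlength (R := R) idfun)^*%mu).

(** * Lower integrals and the completed Lebesgue measure *)

(** The integral of a nonnegative function is by definition a supremum over its
    simple minorants, so it is monotone even on non-measurable functions. *)
Lemma le_lower_integral d (T : measurableType d) (R : realType)
    (mu : {measure set T -> \bar R}) (D : set T) (f g : T -> \bar R) :
  (forall x, D x -> 0 <= f x)%E -> (forall x, D x -> f x <= g x)%E ->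
  (\int[mu]_(x in D) f x <= \int[mu]_(x in D) g x)%E.
Proof.
move=> f0 fg; have g0 x (Dx : D x) : (0 <= g x)%E.
  exact: le_trans (f0 _ Dx) (fg _ Dx).
rewrite !ge0_integralE//; apply: ereal_sup_le => _ [h /= hf <-].
exists h => // x; apply: le_trans (hf x) _.
by apply: lee_restrict.
Qed.

Lemma completed_lebesgue_measureE (R : realType) (A : set R) :
  @completed_lebesgue_measure R A = @lebesgue_measure R A.
Proof.
rewrite /completed_lebesgue_measure /completed_lebesgue_stieltjes_measure.
by rewrite /lebesgue_measure /lebesgue_stieltjes_measure
  /completed_measure_extension /measure_extension.
Qed.

(** The Lebesgue measure is the image of its completion by the identity, which
    is measurable from the completed to the Borel sets. *)
Lemma ge0_integral_completed (R : realType) (D : set R) (f : R -> \bar R) :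
  measurable (D : set (measurableTypeR R)) ->
  measurable_fun (D : set (measurableTypeR R)) f ->
  (forall x, D x -> 0 <= f x)%E ->
  (\int[@completed_lebesgue_measure R]_(x in D) f x =
   \int[@lebesgue_measure R]_(x in D) f x)%E.
Proof.
move=> mD mf f0.
pose phi : completedR R -> measurableTypeR R := idfun.
have mphi : measurable_fun setT phi.
  by move=> _ Y mY; rewrite setTI; exact: sub_caratheodory.
transitivity
    (\int[pushforward (@completed_lebesgue_measure R) phi]_(x in D) f x)%E.
  rewrite ge0_integral_pushforward//.
  by move=> y; rewrite inE; exact: f0.
apply: eq_measure_integral => A mA _.
exact: completed_lebesgue_measureE.
Qed.

Lemma measurable_itv_completed (R : realType) (a b : R) :
  measurable ([set` `[a, b]] : set (completedR R)).
Proof. by apply: sub_caratheodory; exact: measurable_itv. Qed.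

Lemma L1_itv_fin (R : realType) (a b : R) (h : R -> R) : L1_itv a b h ->
  integral_itv a b (EFin \o h) \is a fin_num.
Proof.
by move=> hL; apply: integrable_fin_num => //; exact: measurable_itv_completed.
Qed.

(** * Symmetrization on an interval *)

Lemma ge0_integral_reflect (R : realType) (a b : R) (f : R -> \bar R) :
  measurable_fun [set: measurableTypeR R] f ->
  (forall x, 0 <= f x)%E ->
  (\int[@lebesgue_measure R]_(x in `[a, b]) f (a + b - x)%R =
   \int[@lebesgue_measure R]_(x in `[a, b]) f x)%E.
Proof.
move=> mf f0.
pose phi : measurableTypeR R -> measurableTypeR R := fun x => a + b - x.
have mphi : measurable_fun setT phi by exact: measurable_funB.
have itvE u v c e : phi @^-1` [set` Interval (BSide c u) (BSide e v)] =
   [set` Interval (BSide (~~ e) (a + b - v)) (BSide (~~ c) (a + b - u))].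
  apply/seteqP; split => x /=; rewrite !in_itv/= /phi.
    by case: c; case: e => /= /andP[? ?]; apply/andP; split; lra.
  by case: c; case: e => /= /andP[? ?]; apply/andP; split; lra.
transitivity (\int[pushforward (@lebesgue_measure R) phi]_(x in `[a, b]) f x)%E.
  rewrite ge0_integral_pushforward//; last exact: measurable_funTS.
  have -> // : phi @^-1` `[a, b] = `[a, b]%classic.
  apply/seteqP; split => x; rewrite itvE/= !in_itv/= => /andP[? ?].
    by apply/andP; split; lra.
  by apply/andP; split; lra.
apply: eq_measure_integral => A mA _; apply/esym/lebesgue_measure_unique => //=.
move=> _ [[u v]] _ <-.
rewrite /pushforward itvE/= !lebesgue_measure_itv/= !lte_fin.
rewrite (_ : (a + b - v < a + b - u) = (u < v)); last by apply/idP/idP; lra.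
by case: ifP => // _; rewrite -!EFinD; congr EFin; lra.
Qed.

Lemma symmetrized_integral_ge (R : realType) (a b K : R) (psi : R -> R) :
  a < b -> 0 <= K -> measurable_fun [set: measurableTypeR R] psi ->
  (forall x, 0 <= psi x) ->
  (forall x, x \in `[a, b] -> K <= psi x + psi (a + b - x)) ->
  (((b - a) / 2 * K)%:E <=
    \int[@lebesgue_measure R]_(x in `[a, b]) (psi x)%:E)%E.
Proof.
move=> ab K0 mpsi psi0 psiD.
have mE : measurable_fun [set: measurableTypeR R] (EFin \o psi).
  exact/measurable_EFinP.
have mr : measurable_fun [set: measurableTypeR R]
    (EFin \o (fun x => psi (a + b - x))).
  apply/measurable_EFinP; apply: measurableT_comp => //.
  exact: measurable_funB.
have psi0E x : (0 <= (EFin \o psi) x)%E by rewrite lee_fin.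
have /= refl := ge0_integral_reflect a b mE psi0E.
rewrite -(@lee_pmul2l _ 2%:E)// [leRHS]mule_natl mule2n.
rewrite -[X in (_ <= X + _)%E]refl.
rewrite -ge0_integralD//=; [|by move=> *; rewrite lee_fin
  |exact: measurable_funTS|by move=> *; rewrite lee_fin
  |exact: measurable_funTS].
apply: (@le_trans _ _
    (\int[@lebesgue_measure R]_(x in `[a, b]) (cst K%:E x))%E).
  rewrite integral_cst//= lebesgue_measure_itv/= lte_fin ab -EFinD -!EFinM.
  by rewrite lee_fin; lra.
apply: ge0_le_integral => //=.
- exact: emeasurable_funD (measurable_funTS mr) (measurable_funTS mE).
- by move=> x xab; rewrite -EFinD lee_fin [leRHS]addrC; exact: psiD.
Qed.

(** * A measurable minorant of a Godunova-Levin function *)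

(** N(s) is the infimum of p over [s, H], capped by r(H).  For t in [s, H] the
    hypothesis gives r(s) <= p(t) + q(s), and taking the infimum over t gives
    r(s) - N(s) <= q(s).  The cap r(H) does no harm, since r(s) <= r(H). *)
Lemma nondecreasing_separation (R : realType) (H : R) (p q r : R -> R) :
  0 <= r H ->
  (forall s t, s \in `]0, H] -> t \in `]0, H] -> s <= t -> r s <= r t) ->
  (forall s, s \in `]0, H] -> 0 <= p s) ->
  (forall s, s \in `]0, H] -> 0 <= q s) ->
  (forall s t, s \in `]0, H] -> t \in `]0, H] -> t <= s -> r t <= p s + q t) ->
  exists N : R -> R, [/\ nondecreasing_fun N,
    forall s, 0 <= N s,
    forall s, s \in `]0, H] -> N s <= p s &
    forall s, s \in `]0, H] -> r s - N s <= q s].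
Proof.
move=> rH0 rmono p0 q0 pq.
(* The value r(H) keeps E(s) nonempty for s > H, so that its infimum is
   nondecreasing on the whole line. *)
pose E s := [set z | z = r H \/
  exists t, [/\ t \in `]0, H], s <= t & z = p t]].
have E0 s : lbound (E s) 0 by move=> _ [->//|[t [tH _ ->]]]; exact: p0.
have En s : E s !=set0 by exists (r H); left.
have El s : has_lbound (E s) by exists 0; exact: E0.
exists (fun s => inf (E s)); split.
- move=> s t st; apply: lb_le_inf => // z Ez; apply: ge_inf => //.
  case: Ez => [->|[u [uH tu ->]]]; first by left.
  by right; exists u; split => //; exact: le_trans tu.
- by move=> s; exact: lb_le_inf.
- move=> s sH; apply: ge_inf => //.
  by right; exists s.
- move=> s sH; rewrite lerBlDr -lerBlDl.
  apply: lb_le_inf => // _ [->|[t [tH st ->]]].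
    have HH : H \in `]0, H].
      by move: sH; rewrite !in_itv/= => /andP[? ?]; apply/andP; split; lra.
    have := rmono s H sH HH; have := q0 s sH.
    by move: sH; rewrite in_itv/= => /andP[_ sH ?] /(_ sH); lra.
  by have := pq t s tH sH st; lra.
Qed.

(** Multiplying the Godunova-Levin inequality at m = (a + b) / 2, with weights
    t / (s + t) at m - s and s / (s + t) at m + t, by s t / (s + t) leaves
    h(m) s t / (s + t) on the left, and s / (s + t) >= 1 / 2 when t <= s. *)
Lemma godunova_levin_offset (R : realType) (a b : R) (h : R -> R) (s t : R) :
  godunova_levin `[a, b] h -> 0 < t -> t <= s -> s <= (b - a) / 2 ->
  h ((a + b) / 2) / 2 * t <= s * h ((a + b) / 2 - s) + t * h ((a + b) / 2 + t).
Proof.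
move=> [h0 hQ] t0 ts sH.
set m := (a + b) / 2.
have m0 : 0 <= h m by apply: h0; rewrite in_itv/= /m; apply/andP; split; lra.
have st0 : 0 < s + t by lra.
have := hQ (m - s) (m + t) (t / (s + t)).
have -> : 1 - t / (s + t) = s / (s + t) by field; lra.
have -> : t / (s + t) * (m - s) + s / (s + t) * (m + t) = m by field; lra.
have lt1 : 0 < t / (s + t) < 1.
  by rewrite divr_gt0//= ltr_pdivrMr//; lra.
have m_s : m - s \in `[a, b] by rewrite in_itv/= /m; apply/andP; split; lra.
have m_t : m + t \in `[a, b] by rewrite in_itv/= /m; apply/andP; split; lra.
move=> /(_ m_s m_t lt1).
have -> : h (m - s) / (t / (s + t)) + h (m + t) / (s / (s + t)) =
    (s * h (m - s) + t * h (m + t)) / (s * t / (s + t)) by field; lra.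
rewrite ler_pdivlMr; last by rewrite divr_gt0// mulr_gt0//; lra.
apply: le_trans; rewrite -mulrA ler_wpM2l// ler_pdivlMr//; nra.
Qed.

(** Splitting h(m) / 2 between each point m - s and its mirror image m + s, in
    the shares N(s) / s and h(m) / 2 - N(s) / s, keeps both shares below h. *)
Lemma godunova_levin_minorant (R : realType) (a b : R) (h : R -> R) : a < b ->
  godunova_levin `[a, b] h ->
  exists psi : R -> R, [/\ measurable_fun [set: measurableTypeR R] psi,
    forall x, 0 <= psi x,
    forall x, x \in `[a, b] -> psi x <= h x &
    forall x, x \in `[a, b] ->
      h ((a + b) / 2) / 2 <= psi x + psi (a + b - x)].
Proof.
move=> ab hQ; set m := (a + b) / 2; set K := h m / 2.
have HE s : (s \in `]0, (b - a) / 2]) = (0 < s <= (b - a) / 2).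
  by rewrite in_itv.
have abE x : (x \in `[a, b]) = (a <= x <= b) by rewrite in_itv.
have h0 := hQ.1.
have K0 : 0 <= K by rewrite divr_ge0// h0// abE /m; apply/andP; split; lra.
have [|||||N [Nmono N0 Np Nq]] := @nondecreasing_separation R
    ((b - a) / 2) (fun s => s * h (m - s)) (fun s => s * h (m + s)) ( *%R K).
- by rewrite mulr_ge0//; lra.
- by move=> s t _ _ st; rewrite ler_wpM2l.
- move=> s; rewrite HE => /andP[s0 sH]; rewrite mulr_ge0 ?h0// ?abE; first lra.
  by rewrite /m; apply/andP; split; lra.
- move=> s; rewrite HE => /andP[s0 sH]; rewrite mulr_ge0 ?h0// ?abE; first lra.
  by rewrite /m; apply/andP; split; lra.
- move=> s t; rewrite !HE => /andP[s0 sH] /andP[t0 tH] ts.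
  exact: godunova_levin_offset.
(* The power, a measurable function of s, is 1 / s for s > 0, and
   its value 0 at s = 0 makes psi(m) = h(m) / 2. *)
pose w s := N s * s `^ (-1).
have mw : measurable_fun [set: measurableTypeR R] w.
  apply: measurable_funM; last exact: measurable_powR.
  exact: nondecreasing_measurable.
have w_0 : w 0 = 0 by rewrite /w powR0 ?mulr0// oppr_eq0 oner_eq0.
have wE s : 0 < s -> w s = N s / s by move=> s0; rewrite /w powR_inv1// ltW.
pose psi x := Num.max 0 (if x < m then w (m - x) else K - w (x - m)).
exists psi; split.
- apply: measurable_maxr => //; apply: measurable_fun_ifT => /=.
  + exact: measurable_fun_ltr.
  + by apply: measurableT_comp => //; exact: measurable_funB.
  + apply: measurable_funB => //; apply: measurableT_comp => //.
    exact: measurable_funB.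
- by move=> x; rewrite /psi le_max lexx.
- move=> x xab; rewrite /psi ge_max h0//=.
  move: xab; rewrite abE => /andP[ax xb].
  case: ltgtP => xm.
  + have s0 : 0 < m - x by lra.
    rewrite wE// ler_pdivrMr// mulrC -[in h x](subKr m x).
    by apply: Np; rewrite HE; apply/andP; split; rewrite // /m; lra.
  + have s0 : 0 < x - m by lra.
    rewrite wE// lerBlDr -lerBlDl ler_pdivlMr//.
    have := Nq (x - m); rewrite HE (addrC m) subrK => /(_ _)/wrap[].
      by apply/andP; split; rewrite // /m; lra.
    by lra.
  + have hm : 0 <= h m by rewrite h0// abE /m; apply/andP; split; lra.
    by rewrite xm subrr w_0 /K; lra.
- have le_max0 (z : R) : z <= Num.max 0 z by rewrite le_max lexx orbT.
  have half x : x < m -> K <= psi x + psi (a + b - x).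
    move=> xm; have mr : (a + b - x < m) = false.
      by apply/negbTE; rewrite -leNgt; move: xm; rewrite /m; lra.
    rewrite /psi xm mr (_ : a + b - x - m = m - x); last by rewrite /m; field.
    by have := le_max0 (w (m - x)); have := le_max0 (K - w (m - x)); lra.
  move=> x _; have [/half//|mx|->] := ltgtP x m.
    rewrite addrC -[in X in _ + X](subKr (a + b) x); apply: half.
    by move: mx; rewrite /m; lra.
  rewrite (_ : a + b - m = m); last by rewrite /m; field.
  rewrite /psi ltxx subrr w_0 subr0.
  by have := le_max0 K; lra.
Qed.

(** * The midpoint inequality *)

(** When h is not measurable, the right-hand side is a lower integral, bounded
    below by the integral of the Borel minorant. *)
Lemma godunova_levin_midpoint (R : realType) (a b : R) (h : R -> R) : a < b ->
  godunova_levin `[a, b] h ->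
  (((b - a) / 4 * h ((a + b) / 2))%:E <= integral_itv a b (EFin \o h))%E.
Proof.
move=> ab hQ.
have [psi [mpsi psi0 psih psiD]] := godunova_levin_minorant ab hQ.
have K0 : 0 <= h ((a + b) / 2) / 2.
  by rewrite divr_ge0// hQ.1// in_itv/=; apply/andP; split; lra.
have := symmetrized_integral_ge ab K0 mpsi psi0 psiD.
rewrite -ge0_integral_completed//; last 2 first.
- by apply/measurable_EFinP; exact: measurable_funTS.
- by move=> x _; rewrite lee_fin.
have -> : (b - a) / 2 * (h ((a + b) / 2) / 2) =
    (b - a) / 4 * h ((a + b) / 2) by field.
move=> /le_trans; apply; apply: le_lower_integral => x xab; rewrite lee_fin//.
exact: psih.
Qed.

Lemma godunova_levin_integral (R : realType) (a b c d : R) (f : R -> R -> R) :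
  (forall y, y \in `[c, d] -> godunova_levin `[a, b] (f ^~ y)) ->
  (forall x, x \in `[a, b] -> L1_itv c d (f x)) ->
  godunova_levin `[a, b] (fun x => fine (integral_itv c d (EFin \o f x))).
Proof.
move=> fQ fL; split => [u uab|u v l uab vab /andP[l0 l1]].
  by rewrite fine_ge0// integral_ge0// => y ycd; rewrite lee_fin (fQ y ycd).1.
set w := l * u + (1 - l) * v.
have wab : w \in `[a, b].
  move: uab vab; rewrite !in_itv/= => /andP[? ?] /andP[? ?].
  by rewrite /w; apply/andP; split; nra.
have mcd := measurable_itv_completed c d.
have iu := integrableZl mcd l^-1 (fL u uab).
have iv := integrableZl mcd (1 - l)^-1 (fL v vab).
rewrite -lee_fin EFinD !(mulrC (fine _)) !EFinM.
rewrite !fineK ?L1_itv_fin//; try exact: fL.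
rewrite /integral_itv -!integralZl//; [|exact: fL..].
rewrite -integralD//.
apply: le_lower_integral => y ycd /=; rewrite -?EFinM -?EFinD lee_fin.
  by rewrite (fQ y ycd).1.
rewrite !(mulrC _^-1); apply: (fQ y ycd).2 => //; exact/andP.
Qed.

Theorem theorem7 (R : realType) (a b c d : R) (f : R -> R -> R)
    (hab : a < b) (hcd : c < d)
    (hf : coord_godunova_levin a b c d f)
    (hx : forall x, x \in `[a, b] -> L1_itv c d (f x))
    (hy : forall y, y \in `[c, d] -> L1_itv a b (f ^~ y)) :
  ((1 / 16 * f ((a + b) / 2) ((c + d) / 2))%:E <=
    (1 / 8)%:E *
      ((1 / (b - a))%:E * integral_itv a b (fun x => (f x ((c + d) / 2))%:E) +
       (1 / (d - c))%:E * integral_itv c d (fun y => (f ((a + b) / 2) y)%:E))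
  )%E /\
  ((1 / 8)%:E *
      ((1 / (b - a))%:E * integral_itv a b (fun x => (f x ((c + d) / 2))%:E) +
       (1 / (d - c))%:E * integral_itv c d (fun y => (f ((a + b) / 2) y)%:E)) <=
    (1 / ((b - a) * (d - c)))%:E *
      integral_itv a b (fun x => integral_itv c d (fun y => (f x y)%:E)))%E.
Proof.
have [fQy fQx] := hf.
set m := (a + b) / 2; set m' := (c + d) / 2.
have mab : m \in `[a, b] by rewrite in_itv/= /m; apply/andP; split; lra.
have mcd : m' \in `[c, d] by rewrite in_itv/= /m'; apply/andP; split; lra.
pose g x := fine (integral_itv c d (EFin \o f x)).
have gE x : x \in `[a, b] -> integral_itv c d (EFin \o f x) = (g x)%:E.
  by move=> xab; rewrite fineK//; apply: L1_itv_fin; exact: hx.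
have gQ : godunova_levin `[a, b] g by exact: godunova_levin_integral.
have JE : integral_itv a b (fun x => integral_itv c d (fun y => (f x y)%:E)) =
          integral_itv a b (EFin \o g).
  by apply: eq_integral => x; rewrite inE => xab; exact: gE.
have fI := godunova_levin_midpoint hab (fQy _ mcd).
have fI' := godunova_levin_midpoint hcd (fQx _ mab).
have gI := godunova_levin_midpoint hab gQ.
have fgI : (((d - c) / 4)%:E * integral_itv a b (EFin \o f ^~ m') <=
    integral_itv a b (EFin \o g))%E.
  rewrite /integral_itv -integralZl//; last 2 first.
  - exact: measurable_itv_completed.
  - exact: hy.
  apply: le_lower_integral => x xab /=; rewrite -EFinM.
    by rewrite lee_fin mulr_ge0 ?(fQy _ mcd).1//; lra.
  by rewrite -gE//; exact: godunova_levin_midpoint hcd (fQx _ xab).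
rewrite JE.
change (fun x => (f x m')%:E) with (EFin \o f ^~ m').
change (fun y => (f m y)%:E) with (EFin \o f m).
rewrite -/m -/m' in fI fI' gI.
move: fI fI' gI fgI; rewrite gE// -(fineK (L1_itv_fin (hy _ mcd))).
set I := fine _; set I' := g m.
move: (integral_itv a b (EFin \o g)) => J.
rewrite -!EFinM !lee_fin => fI fI' gI fgI.
have ba0 : 0 < b - a by lra.
have dc0 : 0 < d - c by lra.
have bI : f m m' / 4 <= 1 / (b - a) * I.
  by rewrite div1r [leRHS]mulrC ler_pdivlMr//; lra.
have dI' : f m m' / 4 <= 1 / (d - c) * I'.
  by rewrite div1r [leRHS]mulrC ler_pdivlMr//; lra.
split; first by lra.
have k0 : 0 < 1 / ((b - a) * (d - c)) by rewrite divr_gt0// mulr_gt0.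
(* The iterated integral may be infinite. *)
case: J gI fgI => [J||]; rewrite ?leeNy_eq// ?gt0_muley ?lte_fin// ?leey//.
rewrite -EFinM !lee_fin => gI fgI.
rewrite [leRHS]mulrC [X in _ <= _ * X]div1r ler_pdivlMr ?mulr_gt0//.
have -> : 1 / 8 * (1 / (b - a) * I + 1 / (d - c) * I') * ((b - a) * (d - c)) =
    ((d - c) * I + (b - a) * I') / 8 by field; lra.
by lra.
Qed.
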